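(* Let $X$ be a set, let $\Omega$ be a $\sigma$-algebra of subsets of $X$, let $E$ be a $\sigma$-Dedekind complete partially ordered vector space, and let $\mu:\Omega\to\overline{E^+}$ be an $\overline{E^+}$-valued measure. Let $(f_n)_{n=1}^\infty$ be a sequence of measurable functions $f_n:X\to\mathbb R$, and let $f:X\to\mathbb R$ be a measurable function such that $f_n(x)\to f(x)$ for almost all $x\in X$. Suppose that there exists a measurable function $g:X\to[0,\infty]$ such that $\int_X^{\mathrm o}g\,\mathrm d\mu$ is finite and such that, for all $n\ge1$, $|f_n(x)|\le g(x)$ in $[0,\infty]$ for almost all $x\in X$. Then: (1) $f_n\in\mathcal L^1(X,\Omega,\mu;\mathbb R)$ for all $n\ge 1$; (2) $f\in\mathcal L^1(X,\Omega,\mu;\mathbb R)$; (3) $\displaystyle\bigwedge_{n=1}^\infty\bigvee_{k=n}^\infty\int_X^{\mathrm o}|f_k-f|\,\mathrm d\mu=0$; (4) $\displaystyle\int_X^{\mathrm o}f\,\mathrm d\mu=\bigvee_{n=1}^\infty\bigwedge_{k=n}^\infty\int_X^{\mathrm o}f_k\,\mathrm d\mu=\bigwedge_{n=1}^\infty\bigvee_{k=n}^\infty\int_X^{\mathrm o}f_k\,\mathrm d\mu$.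
   Context: All vector spaces are real. A partially ordered vector space $E$ has a proper positive cone $E^+$ (i.e. $E^+\cap(-E^+)=\{0\}$), not required to be generating. $E$ is $\sigma$-Dedekind complete if every non-empty at most countably infinite subset of $E$ that is bounded from above has a supremum in $E$. Extended space: $\overline{E}=E\cup\{\infty\}$ (disjoint union), ordered by extending the order of $E$ with $x\le\infty$ for all $x\in\overline E$; $\infty+x=x+\infty=\infty$ for all $x\in\overline E$; $r\cdot\infty=\infty$ for real $r>0$ and $0\cdot\infty=0$. $\overline{E^+}=E^+\cup\{\infty\}$. Elements of $E$ are called finite. Measure: an $\overline{E^+}$-valued measure on $\Omega$ is a map $\mu:\Omega\to\overline{E^+}$ with $\mu(\emptyset)=0$ and $\mu\big(\bigcup_{n=1}^\infty\Delta_n\big)=\bigvee_{N=1}^\infty\sum_{n=1}^N\mu(\Delta_n)$ in $\overline E$ for every pairwise disjoint sequence $(\Delta_n)$ in $\Omega$ with union in $\Omega$. A property holds for almost all $x\in X$ if the set of points where it fails is contained in some $\Delta\in\Omega$ with $\mu(\Delta)=0$. Order integral: for $\varphi=\sum_{i=1}^n r_i\chi_{\Delta_i}$ with $r_i\in[0,\infty)$ and pairwise disjoint $\Delta_i\in\Omega$ (an elementary function), $\int_X^{\mathrm o}\varphi\,\mathrm d\mu:=\sum_{i=1}^n r_i\mu(\Delta_i)\in\overline{E^+}$ (independent of the representation). For measurable $f:X\to[0,\infty]$, choose any sequence of elementary functions $\varphi_n\uparrow f$ pointwise and put $\int_X^{\mathrm o}f\,\mathrm d\mu:=\bigvee_{n=1}^\infty\int_X^{\mathrm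 o}\varphi_n\,\mathrm d\mu$ in $\overline E$ (independent of the choice of the sequence). Measurable means $\Omega$–Borel measurable. $\mathcal L^1(X,\Omega,\mu;\mathbb R)$ is the set of measurable $f:X\to\mathbb R$ with $\int_X^{\mathrm o}|f|\,\mathrm d\mu$ finite; for such $f$, write $f=f_1-f_2$ with $f_1,f_2\ge0$ in $\mathcal L^1(X,\Omega,\mu;\mathbb R)$ and put $\int_X^{\mathrm o}f\,\mathrm d\mu:=\int_X^{\mathrm o}f_1\,\mathrm d\mu-\int_X^{\mathrm o}f_2\,\mathrm d\mu\in E$ (independent of the choice of $f_1,f_2$). The suprema and infima in (3) and (4) are taken in $E$. *)

(* Defs.v *)
From HB Require Import structures.
From mathcomp Require Import all_boot all_order all_algebra.
From mathcomp Require Import all_classical all_reals all_analysis.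
From mathcomp Require Import measurable_realfun.
Set Implicit Arguments.
Unset Strict Implicit.
Unset Printing Implicit Defensive.
Import Order.TTheory GRing.Theory Num.Theory.
Import numFieldNormedType.Exports.
Local Open Scope classical_set_scope.
Local Open Scope ring_scope.

(* The positive cone is [set x | 0 <= x]; it is proper by antisymmetry of the
   order, and it is not required to be generating. *)
HB.mixin Record isPOrderedLmodule (R : numDomainType) E
    & Num.POrderedZmodule E & GRing.Lmodule R E := {
  pov_leD2r : forall x y z : E, x <= y -> x + z <= y + z ;
  pov_scale_ge0 : forall (r : R) (x : E), 0 <= r -> 0 <= x -> 0 <= r *: x
}.

#[short(type="porderLmodType")]
HB.structure Definition POrderedLmodule (R : numDomainType) :=
  { E of isPOrderedLmodule R E & Num.POrderedZmodule E & GRing.Lmodule R E }.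

Definition sigma_dedekind_complete (R : numDomainType)
    (E : porderLmodType R) : Prop :=
  forall A : set E, A !=set0 -> countable A -> has_ubound A ->
    supremums A !=set0.

Variant ext (E : Type) := Fin of E | Infty.
Arguments Infty {E}.

Section ExtInstances.
Variables (R : numDomainType) (E : porderLmodType R).
Implicit Types x y z : ext E.

Let to_option x := if x is Fin a then Some a else None.
Let of_option (o : option E) := if o is Some a then Fin a else Infty.

Let to_optionK : cancel to_option of_option.
Proof. by case. Qed.

HB.instance Definition _ := Choice.copy (ext E) (can_type to_optionK).

Definition ext_le x y : bool :=
  match x, y with
  | _, Infty => true
  | Fin a, Fin b => a <= b
  | Infty, Fin _ => false
  end.

Let ext_le_refl : reflexive ext_le.
Proof. by case=> //= a; exact: lexx. Qed.

Let ext_le_anti : antisymmetric ext_le.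
Proof. by case=> [a|] [b|] //= ab; congr Fin; exact: le_anti. Qed.

Let ext_le_trans : transitive ext_le.
Proof. by case=> [b|] [a|] [c|] //=; exact: le_trans. Qed.

HB.instance Definition _ := Order.Le_isPOrder.Build ring_display (ext E)
  ext_le_refl ext_le_anti ext_le_trans.

Definition ext_add x y : ext E :=
  if x is Fin a then if y is Fin b then Fin (a + b) else Infty else Infty.

Let ext_addA : associative ext_add.
Proof. by case=> [a|] [b|] [c|] //=; rewrite addrA. Qed.

Let ext_addC : commutative ext_add.
Proof. by case=> [a|] [b|] //=; rewrite addrC. Qed.

Let ext_add0 : left_id (Fin 0) ext_add.
Proof. by case=> //= a; rewrite add0r. Qed.

HB.instance Definition _ := GRing.isNmodule.Build (ext E)
  ext_addA ext_addC ext_add0.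

(* Only used for 0 <= r. *)
Definition ext_scale (r : R) x : ext E :=
  if x is Fin a then Fin (r *: a) else if r == 0 then Fin 0 else Infty.

End ExtInstances.

Section OrderIntegral.
(* A bare type with an explicit sigma-algebra is used because a measurableType
   is always inhabited. *)
Variables (R : realType) (X : Type) (Omega : set (set X)).
Variable E : porderLmodType R.

(* Only the values of mu on Omega matter. *)
Definition is_ext_measure (mu : set X -> ext E) : Prop :=
  [/\ mu set0 = 0,
      forall D, Omega D -> (0 : ext E) <= mu D &
      forall D : nat -> set X, (forall n, Omega (D n)) -> trivIset setT D ->
        Omega (\bigcup_n D n) ->
        supremums (range (fun N => \sum_(n < N.+1) mu (D n)))
          (mu (\bigcup_n D n))].

Definition measurable_map d (Y : measurableType d) (f : X -> Y) : Prop :=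
  forall B : set Y, measurable B -> Omega (f @^-1` B).

(* A representation \sum_i r_i \chi_{Delta_i} of an elementary function. *)
Record elementary := Elementary {
  el_size : nat ;
  el_coef : 'I_el_size -> R ;
  el_set : 'I_el_size -> set X ;
  el_coef_ge0 : forall i, 0 <= el_coef i ;
  el_set_mem : forall i, Omega (el_set i) ;
  el_set_disj : trivIset setT el_set
}.

Definition el_fun (phi : elementary) (x : X) : R :=
  \sum_(i < el_size phi) el_coef i * \1_(el_set i) x.

Definition increases_to (phi : nat -> elementary) (f : X -> \bar R) : Prop :=
  forall x, nondecreasing_seq (fun n => el_fun (phi n) x) /\
            (el_fun (phi n) x)%:E @[n --> \oo] --> f x.

Variable mu : set X -> ext E.

Definition almost_all (P : X -> Prop) : Prop :=
  exists D, [/\ Omega D, mu D = 0 & [set x | ~ P x] `<=` D].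

Definition el_int (phi : elementary) : ext E :=
  \sum_(i < el_size phi) ext_scale (el_coef i) (mu (el_set i)).

(* Order integral of a measurable f >= 0, computed from a chosen sequence; the
   default Infty is taken when there is no such sequence, so a function that is
   not a limit of elementary functions never has a finite integral. *)
Definition oint (f : X -> \bar R) : ext E :=
  xget Infty [set v | exists phi : nat -> elementary,
    increases_to phi f /\ supremums (range (fun n => el_int (phi n))) v].

Definition L1 (f : X -> R) : Prop :=
  measurable_map f /\ exists v : E, oint (fun x => `|f x|%:E) = Fin v.

(* Order integral of an integrable real-valued f, from a chosen decomposition. *)
Definition Lint (f : X -> R) : E :=
  xget 0 [set v | exists (f1 f2 : X -> R) (v1 v2 : E),
    [/\ L1 f1 /\ L1 f2,
        forall x, 0 <= f1 x /\ 0 <= f2 x,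
        forall x, f x = f1 x - f2 x,
        oint (fun x => (f1 x)%:E) = Fin v1 /\
        oint (fun x => (f2 x)%:E) = Fin v2 &
        v = v1 - v2]].

End OrderIntegral.

(* l = \bigwedge_n \bigvee_(k >= n) u k, all bounds existing in T. *)
Definition is_order_limsup d (T : porderType d) (u : nat -> T) (l : T) : Prop :=
  exists s : nat -> T,
    (forall n, supremums [set u k | k in [set k | (n <= k)%N]] (s n)) /\
    infimums (range s) l.

(* l = \bigvee_n \bigwedge_(k >= n) u k, all bounds existing in T. *)
Definition is_order_liminf d (T : porderType d) (u : nat -> T) (l : T) : Prop :=
  exists s : nat -> T,
    (forall n, infimums [set u k | k in [set k | (n <= k)%N]] (s n)) /\
    supremums (range s) l.

(* Main.v *)
Require Import Defs.
From HB Require Import structures.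
From mathcomp Require Import all_boot all_order all_algebra.
From mathcomp Require Import all_classical all_reals all_analysis.
From mathcomp Require Import finmap measurable_realfun.
Import Order.TTheory GRing.Theory Num.Theory.
Import numFieldNormedType.Exports HBNNSimple.
Local Open Scope classical_set_scope.
Local Open Scope ring_scope.

Set Implicit Arguments.
Unset Strict Implicit.
Unset Printing Implicit Defensive.

(** The integral takes its values in a partially ordered vector space [E] that
    need not be a lattice and may carry no nonzero positive functional, so that
    nothing can be reduced to scalar measures: every estimate has to be made
    in the order of [E].  Two facts about this order carry the whole proof.
    First, sigma-Dedekind completeness forces [E] to be Archimedean
    ([pov_archimedean]), so that [c x <= y] for all [0 < c < 1] entails
    [x <= y].  Second, suprema of increasing sequences commute with finite
    sums and with nonnegative scalings ([ext_sup_add], [ext_sup_scale]).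

    With them, the classical argument for monotone limits survives
    ([el_int_le_limit]): if an elementary function [phi] lies below the limit
    of an increasing sequence [f_n], the part of [c phi] lying below [f_n]
    exhausts [c phi], whence the integral of [c phi] is at most every common
    bound of the integrals of the [f_n]; then [c] tends to [1].  It yields at
    once the independence of the order integral from the approximating
    sequence ([oint_increasing]), its monotonicity up to null sets, its
    additivity, and the monotone convergence theorem.

    For the theorem itself, off one null set [N] the functions
    [u_k = |f_k - f|] tend to [0] and are dominated by [g + g].  Their tails
    [w_n = sup_(k >= n) u_k], set to [0] on [N], are real valued and decrease
    to [0] everywhere; monotone convergence for [w_0 - w_n] shows that their
    integrals [b_n] have infimum [0] ([dominated_null_sequence]).  For
    [k >= n], both the integral of [u_k] and the two differences between the
    integrals of [f_k] and [f] ([Lint_sub_le]) are at most [b_n], and a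
    sequence that is trapped in this way has its order limits where they
    should be ([order_limsup_of_bound], [order_liminf_of_bound]). *)

(** * Order and suprema in a partially ordered vector space *)

Lemma sup_seqP d (T : porderType d) (u : nat -> T) (v : T) :
  supremums (range u) v <->
  (forall n, (u n <= v)%O) /\ (forall w, (forall n, (u n <= w)%O) -> (v <= w)%O).
Proof.
split=> [[ub lb]|[ub lb]]; split.
- by move=> n; apply: ub; exists n.
- by move=> w uw; apply: lb => _ [n _ <-].
- by move=> _ [n _ <-].
- by move=> w uw; apply: lb => n; apply: uw; exists n.
Qed.

Section OrderedVectorSpace.
Variables (R : realType) (E : porderLmodType R).
Implicit Types (x y z t : E) (r c : R).

Lemma pov_leD x y z t : x <= y -> z <= t -> x + z <= y + t.
Proof.
move=> xy zt; apply: le_trans (pov_leD2r _ _ _ xy) _.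
by rewrite ![y + _]addrC; exact: pov_leD2r.
Qed.

Lemma pov_subr_ge0 x y : (0 <= y - x) = (x <= y).
Proof.
apply/idP/idP => [h|h].
  by have := pov_leD2r _ _ x h; rewrite add0r subrK.
by have := pov_leD2r _ _ (- x) h; rewrite subrr.
Qed.

Lemma pov_leBlDr x y z : (x - y <= z) = (x <= z + y).
Proof. by rewrite -(pov_subr_ge0 (x - y)) opprB addrA pov_subr_ge0 addrC. Qed.

Lemma pov_leBrDr x y z : (x <= y - z) = (x + z <= y).
Proof. by rewrite -pov_subr_ge0 -addrA -opprD [z + x]addrC pov_subr_ge0. Qed.

Lemma pov_leN2 x y : (- x <= - y) = (y <= x).
Proof. by rewrite -(pov_subr_ge0 (- x)) opprK addrC pov_subr_ge0. Qed.

Lemma pov_ler_wpZ r x y : 0 <= r -> x <= y -> r *: x <= r *: y.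
Proof.
move=> r0; rewrite -pov_subr_ge0 => xy.
by rewrite -pov_subr_ge0 -scalerBr; exact: pov_scale_ge0.
Qed.

Hypothesis hE : sigma_dedekind_complete E.

Lemma sigma_dedekind_seq_sup (u : nat -> E) y :
  (forall n, u n <= y) -> exists s, supremums (range u) s.
Proof.
move=> uy; have [//| | |s us] := hE (A := range u); last by exists s.
- by exists (u 0); exists 0.
- exact: card_le_trans (card_image_le _ _) (countableP _).
- by exists y => _ [n _ <-].
Qed.

(** If [s] is the supremum of the multiples of [x], then [s - x] bounds them
    as well, because [x *+ n + x] is again a multiple. *)
Lemma pov_archimedean x y : (forall n, x *+ n <= y) -> x <= 0.
Proof.
move=> xy; have [s /sup_seqP[ubs lubs]] := sigma_dedekind_seq_sup xy.
have : s <= s - x by apply: lubs => n; rewrite pov_leBrDr -mulrSr; exact: ubs.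
rewrite pov_leBrDr -(pov_subr_ge0 (s + x)) opprD addrA subrr add0r.
by rewrite -{1}oppr0 pov_leN2.
Qed.

(** Taking [c = n / (n + 1)] gives [n (x - y) <= y] for every [n], and [E] is
    Archimedean. *)
Lemma pov_le_of_scale x y : 0 <= x ->
  (forall c, 0 < c < 1 -> c *: x <= y) -> x <= y.
Proof.
move=> x0 xy.
have y0 : 0 <= y.
  apply: le_trans (xy 2^-1 _); last by rewrite invr_gt0 ltr0n invf_lt1 ?ltr1n.
  by apply: pov_scale_ge0 => //; rewrite invr_ge0 ler0n.
suff /pov_archimedean : forall n, (x - y) *+ n <= y.
  by rewrite pov_leBlDr add0r.
move=> n; rewrite mulrnBl pov_leBlDr -mulrS.
case: n => [|n]; first by rewrite mulr0n.
have c01 : 0 < (n.+1%:R / n.+2%:R : R) < 1.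
  by rewrite divr_gt0 ?ltr0n//= ltr_pdivrMr ?ltr0n// mul1r ltr_nat.
have := pov_ler_wpZ (ler0n R n.+2) (xy _ c01).
by rewrite scalerA mulrCA divff ?pnatr_eq0// mulr1 !scaler_nat.
Qed.

End OrderedVectorSpace.

(** * Order and suprema in the extended space *)
Section ExtendedSpace.
Variables (R : realType) (E : porderLmodType R).
Implicit Types (x y z t : ext E) (r s : R).

Lemma ext_le_infty x : x <= Infty.
Proof. by case: x. Qed.

Lemma ext_leD x y z t : x <= y -> z <= t -> x + z <= y + t.
Proof.
case: y => [b|]; last by move=> _ _; exact: (ext_le_infty (x + z)).
case: t => [d|]; last by move=> _ _; exact: (ext_le_infty (x + z)).
by case: x => [a|//]; case: z => [c|//]; exact: pov_leD.
Qed.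

Lemma ext_addr_ge0 x y : (0 : ext E) <= x -> (0 : ext E) <= y -> (0 : ext E) <= x + y.
Proof. by move=> x0 y0; rewrite -[0 : ext E]addr0; exact: ext_leD. Qed.

Lemma ext_leDl x y : (0 : ext E) <= y -> x <= x + y.
Proof. by move=> y0; rewrite -[leLHS]addr0; exact: ext_leD. Qed.

Lemma ext_le_sum (I : Type) (s : seq I) (P : pred I) (F G : I -> ext E) :
  (forall i, P i -> F i <= G i) -> \sum_(i <- s | P i) F i <= \sum_(i <- s | P i) G i.
Proof.
move=> FG; apply: (big_ind2 (fun x y : ext E => x <= y)) => // *.
exact: ext_leD.
Qed.

Lemma ext_sum_ge0 (I : Type) (s : seq I) (P : pred I) (F : I -> ext E) :
  (forall i, P i -> (0 : ext E) <= F i) -> (0 : ext E) <= \sum_(i <- s | P i) F i.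
Proof.
move=> F0; apply: (big_ind (fun x : ext E => (0 : ext E) <= x)) => // *.
exact: ext_addr_ge0.
Qed.

Lemma ext_scale0r x : ext_scale 0 x = 0.
Proof. by case: x => [a|] /=; rewrite ?scale0r ?eqxx. Qed.

Lemma ext_scaler0 r : ext_scale r 0 = 0 :> ext E.
Proof. by rewrite /= scaler0. Qed.

Lemma ext_scale1 x : ext_scale 1 x = x.
Proof. by case: x => [a|] /=; rewrite ?scale1r ?oner_eq0. Qed.

Lemma ext_scalerD r x y : ext_scale r (x + y) = ext_scale r x + ext_scale r y.
Proof.
have [->|r0] := eqVneq r 0; first by rewrite !ext_scale0r addr0.
case: x => [a|]; case: y => [b|] /=; rewrite ?(negbTE r0)//.
by rewrite scalerDr.
Qed.

Lemma ext_scaler_sum r (I : Type) (s : seq I) (P : pred I) (F : I -> ext E) :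
  ext_scale r (\sum_(i <- s | P i) F i) = \sum_(i <- s | P i) ext_scale r (F i).
Proof. exact: (big_morph _ (ext_scalerD r) (ext_scaler0 r)). Qed.

Lemma ext_scalerA r s x : ext_scale r (ext_scale s x) = ext_scale (r * s) x.
Proof.
case: x => [a|] /=; first by rewrite scalerA.
have [->|s0] := eqVneq s 0; first by rewrite ext_scaler0 mulr0 eqxx.
by rewrite /= mulf_eq0 (negbTE s0) orbF.
Qed.

Lemma ext_scalerDl r s x : 0 <= r -> 0 <= s ->
  ext_scale (r + s) x = ext_scale r x + ext_scale s x.
Proof.
move=> r0 s0; case: x => [a|] /=; first by rewrite scalerDl.
by rewrite paddr_eq0//; case: eqVneq => _; case: eqVneq => _ //=; rewrite addr0.
Qed.

Lemma ext_scale_ge0 r x : 0 <= r -> (0 : ext E) <= x -> (0 : ext E) <= ext_scale r x.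
Proof.
move=> r0; case: x => [a|_] /=; first exact: pov_scale_ge0.
by case: eqVneq => // _; exact: ext_le_infty.
Qed.

Lemma ext_le_wpscale r x y : 0 <= r -> x <= y -> ext_scale r x <= ext_scale r y.
Proof.
move=> r0 xy; have [->|rn0] := eqVneq r 0; first by rewrite !ext_scale0r.
case: y xy => [b|]; last by rewrite /= (negbTE rn0) => _; exact: ext_le_infty.
by case: x => [a|//]; exact: pov_ler_wpZ.
Qed.

Lemma ext_le_wscale r s x : 0 <= r -> r <= s -> (0 : ext E) <= x ->
  ext_scale r x <= ext_scale s x.
Proof.
move=> r0 rs x0; rewrite -(subrK r s) addrC ext_scalerDl ?subr_ge0//.
by apply/ext_leDl/ext_scale_ge0 => //; rewrite subr_ge0.
Qed.

(** For monotone sequences, a bound [w] of the diagonal sums [u n + v n] bounds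
    all [u m + v n]; if [w] is finite, so are all terms, and the two suprema
    can be taken one after the other by moving a term across [<=]. *)
Lemma ext_sup_add (u v : nat -> ext E) x y :
  nondecreasing_seq u -> nondecreasing_seq v ->
  supremums (range u) x -> supremums (range v) y ->
  supremums (range (fun n => u n + v n)) (x + y).
Proof.
move=> ndu ndv /sup_seqP[ux xlub] /sup_seqP[vy ylub]; apply/sup_seqP; split.
  by move=> n; exact: ext_leD.
case=> [w uvw|*]; last exact: ext_le_infty.
have uvmn m n : u m + v n <= Fin w.
  apply: le_trans (uvw (maxn m n)).
  by apply: ext_leD; [apply: ndu; exact: leq_maxl|apply: ndv; exact: leq_maxr].
have /choice[b vb] : forall n, exists b, v n = Fin b.
  move=> n; have := uvmn 0 n.
  by case: (v n) => [b _|]; [exists b|case: (u 0)].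
have xb n : x <= Fin (w - b n).
  apply: xlub => m; have := uvmn m n; rewrite vb.
  by case: (u m) => [a|//]; rewrite /Order.le /= pov_leBrDr.
case: x {ux xlub} xb => [a|] xb; last by have := xb 0.
have : y <= Fin (w - a).
  apply: ylub => n; have := xb n.
  by rewrite vb /Order.le /= !pov_leBrDr addrC.
by case: y {vy ylub} => [b'|//]; rewrite /Order.le /= pov_leBrDr addrC.
Qed.

Lemma ext_sup_sum (I : Type) (s : seq I) (u : I -> nat -> ext E) (x : I -> ext E) :
  (forall i, nondecreasing_seq (u i)) ->
  (forall i, supremums (range (u i)) (x i)) ->
  supremums (range (fun n => \sum_(i <- s) u i n)) (\sum_(i <- s) x i).
Proof.
move=> ndu ux; elim: s => [|i s ih].
  under eq_fun do rewrite big_nil.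
  by rewrite big_nil; apply/sup_seqP; split=> // w /(_ 0).
rewrite big_cons; under eq_fun do rewrite big_cons.
apply: ext_sup_add => // m n mn.
by apply: ext_le_sum => j _; exact: ndu.
Qed.

Lemma ext_sup_scale (r : R) (u : nat -> ext E) x : 0 <= r ->
  supremums (range u) x ->
  supremums (range (fun n => ext_scale r (u n))) (ext_scale r x).
Proof.
move=> r0 /sup_seqP[ux xlub]; apply/sup_seqP; split=> [n|w].
  exact: ext_le_wpscale.
have [->|rn0] := eqVneq r 0.
  by move=> /(_ 0); rewrite !ext_scale0r.
move=> uw; rewrite -[w]ext_scale1 -(mulfV rn0) -ext_scalerA.
apply: ext_le_wpscale => //; apply: xlub => n.
rewrite -[u n]ext_scale1 -(mulVf rn0) -ext_scalerA.
by apply: ext_le_wpscale => //; rewrite invr_ge0.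
Qed.

Hypothesis hE : sigma_dedekind_complete E.

(** A sequence with a finite bound has a supremum in [E]; without one, its
    only upper bound is [Infty]. *)
Lemma ext_sup_exists (u : nat -> ext E) : exists v, supremums (range u) v.
Proof.
have [[w uw]|nu] := pselect (exists w, forall n, u n <= Fin w); last first.
  exists Infty; apply/sup_seqP; split=> [n|[w uw|//]]; first exact: ext_le_infty.
  by case: nu; exists w.
have /choice[a ua] : forall n, exists a, u n = Fin a.
  by move=> n; have := uw n; case: (u n) => [a _|//]; exists a.
have aw n : a n <= w by have := uw n; rewrite ua.
have [s /sup_seqP[ubs lubs]] := sigma_dedekind_seq_sup hE aw.
exists (Fin s); apply/sup_seqP; split=> [n|[b ub|*]]; last exact: ext_le_infty.
  by rewrite ua; exact: ubs.
by apply: lubs => n; have := ub n; rewrite ua.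
Qed.

Lemma ext_le_of_scale x y : (0 : ext E) <= x ->
  (forall c, 0 < c < 1 -> ext_scale c x <= y) -> x <= y.
Proof.
case: y => [b|*]; last exact: ext_le_infty.
case: x => [a|_ /(_ 2^-1)]; first exact: pov_le_of_scale.
by rewrite /= invr_eq0 pnatr_eq0 invr_gt0 ltr0n invf_lt1 ?ltr1n// => /(_ isT).
Qed.

End ExtendedSpace.

(** * Sigma-algebras and measures with values in the extended space *)

Section SigmaAlgebra.
Variables (X : Type) (Omega : set (set X)).
Hypothesis hOmega : sigma_algebra setT Omega.
Implicit Types A B : set X.

Lemma sigma_algebra_set0 : Omega set0.
Proof. by case: hOmega. Qed.

Lemma sigma_algebra_setC A : Omega A -> Omega (~` A).
Proof. by case: hOmega => _ hC _ /hC; rewrite setTD. Qed.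

Lemma sigma_algebra_bigcupT (F : nat -> set X) :
  (forall n, Omega (F n)) -> Omega (\bigcup_n F n).
Proof. by case: hOmega => _ _; exact. Qed.

Lemma sigma_algebra_setT : Omega setT.
Proof. by rewrite -setC0; exact/sigma_algebra_setC/sigma_algebra_set0. Qed.

Lemma sigma_algebra_setU A B : Omega A -> Omega B -> Omega (A `|` B).
Proof.
move=> OA OB; rewrite -bigcup2E; apply: sigma_algebra_bigcupT.
by move=> [|[|n]] //=; exact: sigma_algebra_set0.
Qed.

Lemma sigma_algebra_setI A B : Omega A -> Omega B -> Omega (A `&` B).
Proof.
move=> OA OB; rewrite -[A `&` B]setCK setCI.
by apply/sigma_algebra_setC/sigma_algebra_setU; exact: sigma_algebra_setC.
Qed.

Lemma sigma_algebra_setD A B : Omega A -> Omega B -> Omega (A `\` B).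
Proof.
move=> OA OB; rewrite setDE; apply: sigma_algebra_setI => //.
exact: sigma_algebra_setC.
Qed.

Lemma sigma_algebra_bigsetU (I : Type) (s : seq I) (F : I -> set X) :
  (forall i, Omega (F i)) -> Omega (\big[setU/set0]_(i <- s) F i).
Proof.
move=> OF; apply: (big_ind Omega) => //; first exact: sigma_algebra_set0.
exact: sigma_algebra_setU.
Qed.

End SigmaAlgebra.

Section Measure.
Variables (R : realType) (X : Type) (Omega : set (set X)).
Hypothesis hOmega : sigma_algebra setT Omega.
Variable E : porderLmodType R.
Variable mu : set X -> ext E.
Hypothesis hmu : is_ext_measure Omega mu.
Implicit Types A B : set X.

Lemma ext_measure0 : mu set0 = 0.
Proof. by case: hmu. Qed.

Lemma ext_measure_ge0 A : Omega A -> (0 : ext E) <= mu A.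
Proof. by case: hmu => _ + _; exact. Qed.

Lemma ext_measure_sigma_additive (F : nat -> set X) :
  (forall n, Omega (F n)) -> trivIset setT F ->
  supremums (range (fun N => \sum_(n < N.+1) mu (F n))) (mu (\bigcup_n F n)).
Proof.
by case: hmu => _ _ h OF tF; apply: h => //; exact: (sigma_algebra_bigcupT hOmega).
Qed.

Lemma ext_measureU A B : Omega A -> Omega B -> A `&` B = set0 ->
  mu (A `|` B) = mu A + mu B.
Proof.
move=> OA OB AB.
have tAB : trivIset setT (bigcup2 A B) by rewrite -trivIset_bigcup2.
have OAB n : Omega (bigcup2 A B n).
  by case: n => [|[|n]] //=; exact: (sigma_algebra_set0 hOmega).
have := ext_measure_sigma_additive OAB tAB; rewrite bigcup2E => /sup_seqP[].
move=> ub lub; apply/le_anti/andP; split.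
  apply: lub => -[|n]; first by rewrite big_ord1; exact/ext_leDl/ext_measure_ge0.
  rewrite 2!big_ord_recl /= big1 ?addr0// => i _.
  by rewrite /bigcup2 /= ext_measure0.
by have := ub 1; rewrite 2!big_ord_recl big_ord0 addr0.
Qed.

Lemma ext_measure_le A B : Omega A -> Omega B -> A `<=` B -> mu A <= mu B.
Proof.
move=> OA OB AB; rewrite -(setDUK AB) ext_measureU ?setDIK//; last first.
  exact: (sigma_algebra_setD hOmega).
by apply: ext_leDl; apply: ext_measure_ge0; exact: (sigma_algebra_setD hOmega).
Qed.

(** Finite additivity in the form in which it is used: a measurable set is cut
    along the cells of a partition. *)
Lemma ext_measure_partition (I : finType) (P : I -> set X) A :
  Omega A -> (forall i, Omega (P i)) -> trivIset setT P ->
  A `<=` \bigcup_i P i -> mu A = \sum_i mu (A `&` P i).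
Proof.
move=> OA OP tP AP.
suff h (s : seq I) : uniq s ->
    mu (A `&` \big[setU/set0]_(i <- s) P i) = \sum_(i <- s) mu (A `&` P i).
  rewrite -big_enum -h ?enum_uniq//; congr mu; apply/esym/setIidPl => x /AP[i _ Pix].
  by rewrite -bigcup_seq; exists i => //=; rewrite mem_enum.
elim: s => [_|i s ih /= /andP[si us]].
  by rewrite !big_nil setI0 ext_measure0.
rewrite !big_cons setIUr ext_measureU; last first.
- rewrite -setIACA setIid -bigcup_seq setI_bigcupr bigcup0 ?setI0// => j /= sj.
  apply/eqP; apply: contraNT si => /set0P ij.
  by rewrite (tP i j).
- by apply: (sigma_algebra_setI hOmega) => //; exact: (sigma_algebra_bigsetU hOmega).
- exact: (sigma_algebra_setI hOmega).
- by rewrite ih.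
Qed.

Lemma ext_measure_cvg_below (F : nat -> set X) A :
  (forall n, Omega (F n)) -> nondecreasing_seq F -> \bigcup_n F n = A ->
  supremums (range (fun n => mu (F n))) (mu A).
Proof.
move=> OF ndF <-.
have OD n : Omega (seqD F n).
  by case: n => [|n] //=; exact: (sigma_algebra_setD hOmega).
rewrite -eq_bigcup_seqD.
have -> : (fun n => mu (F n)) = (fun N => \sum_(n < N.+1) mu (seqD F n)).
  apply/funext => n; apply/esym.
  elim: n => [|n ih]; first by rewrite big_ord1.
  rewrite big_ord_recr /= ih -ext_measureU ?setDIK//; last first.
    exact: (sigma_algebra_setD hOmega).
  by congr mu; apply: setDUK; exact/subsetPset/ndF.
by apply: ext_measure_sigma_additive OD _; exact: trivIset_seqD.
Qed.

(** After disjointification, all partial sums in the defining supremum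
    vanish. *)
Lemma ext_measure_null_bigcup (F : nat -> set X) :
  (forall n, Omega (F n)) -> (forall n, mu (F n) = 0) -> mu (\bigcup_n F n) = 0.
Proof.
move=> OF F0; rewrite seqDU_bigcup_eq.
have OD n : Omega (seqDU F n).
  by apply: (sigma_algebra_setD hOmega) => //; exact: (sigma_algebra_bigsetU hOmega).
have /sup_seqP[_ lub] := ext_measure_sigma_additive OD (@trivIset_seqDU _ F).
apply/le_anti/andP; split; last first.
  by apply: ext_measure_ge0; exact: (sigma_algebra_bigcupT hOmega).
apply: lub => n; rewrite big1// => i _; apply/le_anti/andP; split.
  by rewrite -[leRHS](F0 i); apply: ext_measure_le => //; exact: subDsetl.
exact: ext_measure_ge0.
Qed.

End Measure.

Lemma fin_bigcupE (X : Type) (I : finType) (F : I -> set X) :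
  \bigcup_i F i = \big[setU/set0]_i F i.
Proof.
rewrite -big_enum -bigcup_seq; apply: eq_bigcupl.
by split=> i //= _; rewrite mem_enum.
Qed.

Lemma trivIset_eq (X I : Type) (P : I -> set X) i j x :
  trivIset setT P -> P i x -> P j x -> i = j.
Proof. by move=> tP Pi Pj; apply: tP => //; exists x. Qed.

(** * Elementary functions *)

Section MeasurablePartition.
Variables (X : Type) (Omega : set (set X)).
Hypothesis hOmega : sigma_algebra setT Omega.

Definition measurable_partition (I : Type) (P : I -> set X) : Prop :=
  [/\ forall i, Omega (P i), trivIset setT P & forall x, exists i, P i x].

Lemma measurable_partitionI (I J : Type) (P : I -> set X) (Q : J -> set X) :
  measurable_partition P -> measurable_partition Q ->
  measurable_partition (fun k : I * J => P k.1 `&` Q k.2).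
Proof.
move=> [OP tP cP] [OQ tQ cQ]; split=> [k|[i j] [i' j'] _ _|x].
- exact: sigma_algebra_setI.
- move=> [x /= [[Pi Qj] [Pi' Qj']]].
  by rewrite (trivIset_eq tP Pi Pi') (trivIset_eq tQ Qj Qj').
- by have [i Pix] := cP x; have [j Qjx] := cQ x; exists (i, j).
Qed.

Variables (R : realType) (E : porderLmodType R).
Variable mu : set X -> ext E.
Hypothesis hmu : is_ext_measure Omega mu.

Definition partition_int (I : finType) (P : I -> set X) (c : I -> R) : ext E :=
  \sum_i ext_scale (c i) (mu (P i)).

Lemma partition_int_refine (I J : finType) (P : I -> set X) (Q : J -> set X) c :
  measurable_partition P -> measurable_partition Q ->
  partition_int P c = \sum_i \sum_j ext_scale (c i) (mu (P i `&` Q j)).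
Proof.
move=> [OP _ _] [OQ tQ cQ]; apply: eq_bigr => i _; rewrite -ext_scaler_sum.
congr ext_scale; apply: (ext_measure_partition hOmega hmu) => // x _.
by have [j Qjx] := cQ x; exists j.
Qed.

(** Comparing two step functions requires a common refinement: on a nonempty
    cell [P i `&` Q j] the values are ordered by hypothesis, and the empty
    cells have measure [0]. *)
Lemma partition_int_le (I J : finType) (P : I -> set X) (Q : J -> set X) c d :
  measurable_partition P -> measurable_partition Q -> (forall i, 0 <= c i) ->
  (forall i j x, P i x -> Q j x -> c i <= d j) ->
  partition_int P c <= partition_int Q d.
Proof.
move=> mP mQ c0 cd; rewrite (partition_int_refine c mP mQ).
rewrite (partition_int_refine d mQ mP) [leRHS]exchange_big /=.
apply: ext_le_sum => i _; apply: ext_le_sum => j _; rewrite [Q j `&` _]setIC.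
have [->|/set0P[x [Pi Qj]]] := eqVneq (P i `&` Q j) set0.
  by rewrite (ext_measure0 hmu) !ext_scaler0.
apply: ext_le_wscale => //; first exact: cd Pi Qj.
by apply: (ext_measure_ge0 hmu); case: mP mQ => OP _ _ [OQ _ _]; exact: sigma_algebra_setI.
Qed.

End MeasurablePartition.

Section Elementary.
Variables (R : realType) (X : Type) (Omega : set (set X)).
Hypothesis hOmega : sigma_algebra setT Omega.
Implicit Types phi psi : elementary R Omega.

(** The sets of an elementary function need not cover the space.  The index
    [None] stands for the complement of their union, where the function is
    [0], and completes them to a partition. *)
Definition el_cell phi (o : option 'I_(el_size phi)) : set X :=
  if o is Some i then @el_set _ _ _ phi i else ~` \bigcup_i @el_set _ _ _ phi i.

Definition el_val phi (o : option 'I_(el_size phi)) : R :=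
  if o is Some i then @el_coef _ _ _ phi i else 0.

Lemma el_val_ge0 phi o : 0 <= @el_val phi o.
Proof. by case: o => [i|] //=; exact: el_coef_ge0. Qed.

Lemma el_cell_partition phi : measurable_partition Omega (@el_cell phi).
Proof.
split=> [[i|]|[i|] [j|] _ _|x].
- exact: el_set_mem.
- apply: sigma_algebra_setC => //; rewrite fin_bigcupE.
  by apply: sigma_algebra_bigsetU => // i; exact: el_set_mem.
- by move=> ij; congr Some; apply: el_set_disj ij.
- by move=> [x [ix]]; case; exists i.
- by move=> [x [+ jx]]; case; exists j.
- by [].
- have [[i _ ix]|nx] := pselect ((\bigcup_i @el_set _ _ _ phi i) x).
    by exists (Some i).
  by exists None.
Qed.

Lemma el_fun_cell phi o x : @el_cell phi o x -> el_fun phi x = el_val o.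
Proof.
rewrite /el_fun; case: o => [i ix|nx] /=.
  rewrite (bigD1 i) //= big1 ?addr0; first by rewrite indicE mem_set// mulr1.
  move=> j ji; rewrite indicE memNset ?mulr0// => jx.
  by move/eqP: ji; apply; exact: trivIset_eq (@el_set_disj _ _ _ phi) jx ix.
rewrite big1// => i _; rewrite indicE memNset ?mulr0// => ix.
by apply: nx; exists i.
Qed.

Lemma el_fun_ge0 phi x : 0 <= el_fun phi x.
Proof.
have [_ _ cP] := el_cell_partition phi; have [k kx] := cP x.
by rewrite (el_fun_cell kx); exact: el_val_ge0.
Qed.

Lemma el_fun_le phi (b : \bar R) x : (0 <= b)%E ->
  (forall i, @el_set _ _ _ phi i x -> ((@el_coef _ _ _ phi i)%:E <= b)%E) ->
  ((el_fun phi x)%:E <= b)%E.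
Proof.
move=> b0 ib; have [_ _ cP] := el_cell_partition phi; have [k kx] := cP x.
by rewrite (el_fun_cell kx); case: k kx => [i|//]; exact: ib.
Qed.

Lemma el_fun_superlevel phi (r : R) : Omega [set x | r <= el_fun phi x].
Proof.
have [OP _ cP] := el_cell_partition phi.
rewrite (_ : mkset _ = \bigcup_o (if r <= el_val o then @el_cell phi o else set0)).
  rewrite fin_bigcupE; apply: sigma_algebra_bigsetU => // o.
  by case: ifP => // _; exact: sigma_algebra_set0.
apply/seteqP; split=> x /=.
  by have [k kx] := cP x; rewrite (el_fun_cell kx) => ro; exists k => //; rewrite ro.
by move=> [k _]; case: ifP => // ro /el_fun_cell ->.
Qed.

Section OfPartition.
Variables (I : finType) (P : I -> set X) (c : I -> R).
Hypothesis mP : measurable_partition Omega P.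
Hypothesis c0 : forall i, 0 <= c i.

Let el_of_mem (k : 'I_#|I|) : Omega (P (enum_val k)).
Proof. by case: mP. Qed.

Let el_of_disj : trivIset setT (fun k : 'I_#|I| => P (enum_val k)).
Proof.
case: mP => _ tP _ k l _ _ [x [kx lx]].
by apply: enum_val_inj; exact: trivIset_eq tP kx lx.
Qed.

Definition el_of_partition : elementary R Omega :=
  Elementary (fun k => c0 (enum_val k)) el_of_mem el_of_disj.

Lemma el_fun_of_partition i x : P i x -> el_fun el_of_partition x = c i.
Proof.
move=> ix.
have h : @el_cell el_of_partition (Some (enum_rank i)) x by rewrite /= enum_rankK.
by rewrite (el_fun_cell h) /= enum_rankK.
Qed.

Lemma el_int_of_partition (E : porderLmodType R) (mu : set X -> ext E) :
  el_int mu el_of_partition = partition_int mu P c.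
Proof. by rewrite /partition_int (big_enum_val (A := predT)). Qed.

End OfPartition.

Section Cut.
Variables (phi : elementary R Omega) (r : R) (A : 'I_(el_size phi) -> set X).
Hypothesis r0 : 0 <= r.
Hypothesis OA : forall i, Omega (A i).

Let el_cut_ge0 i : 0 <= r * @el_coef _ _ _ phi i.
Proof. by rewrite mulr_ge0// el_coef_ge0. Qed.

Let el_cut_mem i : Omega (@el_set _ _ _ phi i `&` A i).
Proof. by apply: sigma_algebra_setI => //; exact: el_set_mem. Qed.

Let el_cut_disj : trivIset setT (fun i => @el_set _ _ _ phi i `&` A i).
Proof.
move=> i j _ _ [x [[ix _] [jx _]]].
exact: trivIset_eq (@el_set_disj _ _ _ phi) ix jx.
Qed.

(** Shrinking the sets separately and scaling the coefficients gives the
    minorants [c phi] restricted to superlevel sets as well as the restriction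
    of [phi] to the complement of a null set. *)
Definition el_cut : elementary R Omega :=
  Elementary el_cut_ge0 el_cut_mem el_cut_disj.

End Cut.

Variables (E : porderLmodType R) (mu : set X -> ext E).
Hypothesis hmu : is_ext_measure Omega mu.

Lemma el_int_cells phi :
  el_int mu phi = partition_int mu (@el_cell phi) (@el_val phi).
Proof.
rewrite /partition_int (bigD1 None)//= ext_scale0r add0r.
rewrite (reindex_omap Some id) => [|[]//].
by apply: eq_bigl => i; rewrite /= eqxx.
Qed.

Lemma el_int_le phi psi : (forall x, el_fun phi x <= el_fun psi x) ->
  el_int mu phi <= el_int mu psi.
Proof.
move=> le; rewrite !el_int_cells; apply: (partition_int_le hOmega hmu).
- exact: el_cell_partition.
- exact: el_cell_partition.
- exact: el_val_ge0.
- by move=> i j x ix jx; rewrite -(el_fun_cell ix) -(el_fun_cell jx).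
Qed.

Lemma el_int_ge0 phi : (0 : ext E) <= el_int mu phi.
Proof.
apply: ext_sum_ge0 => i _; apply: ext_scale_ge0; first exact: el_coef_ge0.
by apply: (ext_measure_ge0 hmu); exact: el_set_mem.
Qed.

(** The sum needs a representation with disjoint sets, hence the product of
    the two completed partitions. *)
Definition el_add phi psi : elementary R Omega :=
  el_of_partition
    (measurable_partitionI hOmega (el_cell_partition phi) (el_cell_partition psi))
    (fun k => addr_ge0 (el_val_ge0 k.1) (el_val_ge0 k.2)).

Lemma el_fun_add phi psi x :
  el_fun (el_add phi psi) x = el_fun phi x + el_fun psi x.
Proof.
have [_ _ cP] := el_cell_partition phi; have [i ix] := cP x.
have [_ _ cQ] := el_cell_partition psi; have [j jx] := cQ x.
rewrite (el_fun_cell ix) (el_fun_cell jx).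
rewrite /el_add; set P := (fun k => _); set c := (fun k => _).
have Pij : P (i, j) x by [].
by rewrite (el_fun_of_partition _ _ Pij).
Qed.

Lemma el_int_add phi psi :
  el_int mu (el_add phi psi) = el_int mu phi + el_int mu psi.
Proof.
have mP := el_cell_partition phi; have mQ := el_cell_partition psi.
rewrite (el_int_cells phi) (el_int_cells psi) (partition_int_refine hOmega hmu _ mP mQ).
rewrite (partition_int_refine hOmega hmu _ mQ mP).
rewrite [X in _ + X]exchange_big -big_split /=.
rewrite el_int_of_partition /partition_int /= -(pair_bigA _ (fun i j =>
  ext_scale (el_val i + el_val j) (mu (el_cell i `&` el_cell j)))) /=.
apply: eq_bigr => i _; rewrite -big_split; apply: eq_bigr => j _ /=.
by rewrite ext_scalerDl ?el_val_ge0// [in RHS](setIC (el_cell j)).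
Qed.

Hypothesis hE : sigma_dedekind_complete E.

(** The heart of the theory.  For [0 < c < 1], cut the [i]-th set of [phi] down
    to the points where [f_n] is at least [c] times the [i]-th coefficient.
    The resulting elementary function lies below [f_n], so that its integral
    is at most [v]; as [n] grows, these sets exhaust those of [phi], so that
    the integral of [c phi] is at most [v] too.  Strictness of [c < 1] matters
    because [f_n] may stay strictly below its limit. *)
Lemma el_int_le_limit phi (f_ : nat -> X -> \bar R) (f : X -> \bar R) (v : ext E) :
  (forall n r, Omega [set x | (r%:E <= f_ n x)%E]) ->
  (forall n x, (0 <= f_ n x)%E) ->
  (forall x, nondecreasing_seq (f_ ^~ x)) ->
  (forall x, f_ n x @[n --> \oo] --> f x) ->
  (forall x, ((el_fun phi x)%:E <= f x)%E) ->
  (forall n psi, (forall x, ((el_fun psi x)%:E <= f_ n x)%E) -> el_int mu psi <= v) ->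
  el_int mu phi <= v.
Proof.
move=> Of f0 ndf cvgf phif fv; apply: (ext_le_of_scale hE (el_int_ge0 phi)).
move=> c /andP[c0 c1].
pose A n i := [set x | ((c * @el_coef _ _ _ phi i)%:E <= f_ n x)%E].
pose psi n := el_cut (ltW c0) (fun i => Of n (c * @el_coef _ _ _ phi i)).
have psiv n : el_int mu (psi n) <= v.
  apply: (fv n) => x; apply: el_fun_le => // i /=.
  by move=> [].
suff /sup_seqP[_] : supremums (range (fun n => el_int mu (psi n)))
    (ext_scale c (el_int mu phi)) by exact.
rewrite ext_scaler_sum; under eq_bigr do rewrite ext_scalerA.
have ndA i : nondecreasing_seq (fun n => @el_set _ _ _ phi i `&` A n i).
  move=> m n mn; apply/subsetPset => x [ix Amx]; split=> //.
  by apply: le_trans Amx _; exact: ndf.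
have OA n i : Omega (@el_set _ _ _ phi i `&` A n i).
  by apply: sigma_algebra_setI => //; [exact: el_set_mem|exact: Of].
have cr0 i : 0 <= c * @el_coef _ _ _ phi i.
  by rewrite mulr_ge0 ?el_coef_ge0// ltW.
have -> : (fun n => el_int mu (psi n)) =
    fun n => \sum_i ext_scale (c * @el_coef _ _ _ phi i)
      (mu (@el_set _ _ _ phi i `&` A n i)) by [].
apply: ext_sup_sum => i.
  move=> m n mn; apply: ext_le_wpscale => //=.
  have /subsetPset Amn := ndA i _ _ mn.
  exact: (ext_measure_le hOmega hmu (OA m i) (OA n i) Amn).
apply: ext_sup_scale => //=.
apply: (ext_measure_cvg_below hOmega hmu) => //.
apply/seteqP; split=> [x [n _ []//]|x ix].
apply: contrapT => nx.
have ltf n : (f_ n x <= (c * @el_coef _ _ _ phi i)%:E)%E.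
  rewrite leNgt; apply/negP => /ltW h; apply: nx; exists n => //; split=> //.
have rf := phif x; rewrite (@el_fun_cell phi (Some i) x ix) /= in rf.
have fr : (f x <= (c * @el_coef _ _ _ phi i)%:E)%E.
  by apply: (cvge_to_le (cvgf x)); exact: nearW.
have := le_trans rf fr; rewrite lee_fin.
have := @el_coef_ge0 _ _ _ phi i; rewrite le_eqVlt => /predU1P[r0 _|r0].
  by apply: nx; exists 0 => //; split=> //; rewrite /A /= -r0 mulr0.
by rewrite ler_pMl// leNgt c1.
Qed.

End Elementary.

(** * Measurable maps and approximation by elementary functions *)

Section MeasurableMaps.
Variables (R : realType) (X : Type) (Omega : set (set X)).
Hypothesis hOmega : sigma_algebra setT Omega.

Lemma measurable_map_superlevel (f : X -> \bar R) (r : R) :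
  measurable_map Omega f -> Omega [set x | (r%:E <= f x)%E].
Proof.
move=> /(_ `[r%:E, +oo%E]%classic (emeasurable_itv _)).
rewrite (_ : _ @^-1` _ = [set x | (r%:E <= f x)%E])//.
by apply/seteqP; split=> x /=; rewrite in_itv /= leey andbT.
Qed.

Lemma measurable_map_comp d1 d2 (Y : measurableType d1) (Z : measurableType d2)
    (h : Y -> Z) (f : X -> Y) :
  measurable_fun setT h -> measurable_map Omega f -> measurable_map Omega (h \o f).
Proof.
move=> mh mf B mB; rewrite comp_preimage; apply: mf.
by rewrite -[_ @^-1` _]setTI; exact: mh.
Qed.

End MeasurableMaps.

Section PointedMeasurableMaps.
Variables (X : pointedType) (Omega : set (set X)).
Hypothesis hOmega : sigma_algebra setT Omega.

(** On a pointed space, [Omega] makes the space a measurable type, which gives access to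
    the measurability of compositions, pairs and suprema; the empty space is
    treated apart in the lemmas below. *)
Lemma measurable_mapP d (Y : measurableType d) (f : X -> Y) :
  measurable_map Omega f <->
  measurable_fun setT (f : g_sigma_algebraType Omega -> Y).
Proof.
have mE : @measurable _ (g_sigma_algebraType Omega) = Omega := sigma_algebra_id hOmega.
split=> [mf _ B mB|mf B mB]; first by rewrite setTI mE; exact: mf.
by have := mf measurableT B mB; rewrite setTI mE.
Qed.

Lemma elementary_of_nnsfun (R : realType)
    (s : {nnsfun (g_sigma_algebraType Omega) >-> R}) :
  exists phi : elementary R Omega, forall x, el_fun phi x = s x.
Proof.
have mE : @measurable _ (g_sigma_algebraType Omega) = Omega := sigma_algebra_id hOmega.
pose V := fset_set (range s).
have sV x : s x \in V by rewrite in_fset_set //; exact/mem_set/imageT.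
pose P (v : V) := s @^-1` [set val v].
have mP : measurable_partition Omega P.
  split=> [v|v w _ _ [x [vx wx]]|x].
  - by rewrite -mE -[P v]setTI; exact: measurable_funP.
  - by apply: val_inj; rewrite -vx -wx.
  - by exists [` sV x]%fset.
have V0 (v : V) : 0 <= val v.
  have := valP v; rewrite in_fset_set // => /set_mem[x _ <-]; exact: fun_ge0.
exists (el_of_partition mP V0) => x.
by rewrite (el_fun_of_partition mP V0 (i := [` sV x]%fset)).
Qed.

End PointedMeasurableMaps.

Lemma measurable_map_comp2 (X : Type) (Omega : set (set X))
    (hOmega : sigma_algebra setT Omega) d1 d2 d3 (Y1 : measurableType d1)
    (Y2 : measurableType d2) (Z : measurableType d3)
    (h : Y1 * Y2 -> Z) (f : X -> Y1) (g : X -> Y2) :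
  measurable_fun setT h -> measurable_map Omega f -> measurable_map Omega g ->
  measurable_map Omega (fun x => h (f x, g x)).
Proof.
move=> mh mf mg; apply: (measurable_map_comp (f := fun x => (f x, g x)) mh).
elim/Ppointed: X => T in Omega hOmega f g mf mg *.
  by move=> B _; rewrite emptyE_subdef; exact: sigma_algebra_set0.
apply/measurable_mapP => //.
by apply: measurable_fun_pair; exact/measurable_mapP.
Qed.

Lemma measurable_map_sups (R : realType) (X : Type) (Omega : set (set X))
    (hOmega : sigma_algebra setT Omega) (h : nat -> X -> R) n :
  (forall x, has_ubound (range (h ^~ x))) ->
  (forall m, measurable_map Omega (h m)) ->
  measurable_map Omega (fun x => sups (h ^~ x) n).
Proof.
elim/Ppointed: X => T in Omega hOmega h *.
  by move=> _ _ B _; rewrite emptyE_subdef; exact: sigma_algebra_set0.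
move=> ubh mh; apply/measurable_mapP => //.
apply: (@measurable_fun_sups _ (g_sigma_algebraType Omega)) => // m.
exact/measurable_mapP.
Qed.

Lemma elementary_approximation (R : realType) (X : Type) (Omega : set (set X))
    (hOmega : sigma_algebra setT Omega) (f : X -> \bar R) :
  measurable_map Omega f -> (forall x, (0 <= f x)%E) ->
  exists phi_ : nat -> elementary R Omega, increases_to phi_ f.
Proof.
elim/Ppointed: X => T in Omega hOmega f *.
  have mP : measurable_partition Omega (fun _ : void => set0).
    by split=> [[]//|[]//|x]; case: (no x).
  by exists (fun=> el_of_partition (c := fun=> 0) mP (fun=> lexx 0)) => x; case: (no x).
move=> /measurable_mapP-/(_ hOmega) mf f0.
pose s := nnsfun_approx (@measurableT _ (g_sigma_algebraType Omega)) mf.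
have /choice[phi_ phiE] : forall n, exists phi : elementary R Omega,
    forall x, el_fun phi x = s n x.
  by move=> n; exact: elementary_of_nnsfun.
exists phi_ => x; split=> [m n mn|].
  rewrite !phiE; have /lefP := nd_nnsfun_approx measurableT mf mn; exact.
under eq_fun do rewrite phiE.
exact: cvg_nnsfun_approx.
Qed.

(** * The order integral of nonnegative functions *)

Section OrderIntegralTheory.
Variables (R : realType) (X : Type) (Omega : set (set X)).
Hypothesis hOmega : sigma_algebra setT Omega.
Variable E : porderLmodType R.
Hypothesis hE : sigma_dedekind_complete E.
Variable mu : set X -> ext E.
Hypothesis hmu : is_ext_measure Omega mu.
Implicit Types (f g : X -> \bar R) (phi : elementary R Omega).

Definition nonneg_measurable f : Prop :=
  measurable_map Omega f /\ forall x, (0 <= f x)%E.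

Lemma increases_to_ge (phi_ : nat -> elementary R Omega) f n x :
  increases_to phi_ f -> ((el_fun (phi_ n) x)%:E <= f x)%E.
Proof.
move=> /(_ x)[nd cv]; apply: (cvge_to_ge cv).
by near=> m; rewrite lee_fin; apply: nd; near: m; exact: nbhs_infty_ge.
Unshelve. all: by end_near. Qed.

Lemma el_int_le_increasing phi (phi_ : nat -> elementary R Omega) f v :
  increases_to phi_ f -> (forall x, ((el_fun phi x)%:E <= f x)%E) ->
  (forall n, el_int mu (phi_ n) <= v) -> el_int mu phi <= v.
Proof.
move=> phif le_phif le_v.
apply: (@el_int_le_limit _ _ _ hOmega _ _ hmu hE phi
  (fun n x => (el_fun (phi_ n) x)%:E) f) => //.
- by move=> n r; under eq_set do rewrite lee_fin; exact: el_fun_superlevel.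
- by move=> n x; rewrite lee_fin; exact: el_fun_ge0.
- by move=> x m n mn; rewrite lee_fin; apply: (phif x).1.
- by move=> x; exact: (phif x).2.
- move=> n psi le_psi; apply: le_trans (le_v n).
  by apply: (el_int_le hOmega hmu) => x; rewrite -lee_fin.
Qed.

(** Any approximating sequence computes the integral: two such sequences
    [phi_] and [psi_] have the same bounds for their integrals, since every
    term of one lies below the limit of the other. *)
Lemma oint_increasing (phi_ : nat -> elementary R Omega) f :
  increases_to phi_ f ->
  supremums (range (fun n => el_int mu (phi_ n))) (oint Omega mu f).
Proof.
move=> phif; rewrite /oint; case: xgetP => [v _ [psi_ [psif /sup_seqP[ub lub]]]|].
  apply/sup_seqP; split=> [n|w le_w].
    by apply: (el_int_le_increasing psif) => // x; exact: increases_to_ge.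
  apply: lub => n; apply: (el_int_le_increasing phif) => // x.
  exact: increases_to_ge.
have [v sup_v] := ext_sup_exists hE (fun n => el_int mu (phi_ n)).
by move=> /(_ v) []; exists phi_.
Qed.

Lemma el_int_le_oint phi f : nonneg_measurable f ->
  (forall x, ((el_fun phi x)%:E <= f x)%E) -> el_int mu phi <= oint Omega mu f.
Proof.
move=> [mf f0] phif; have [phi_ phi_f] := elementary_approximation hOmega mf f0.
have /sup_seqP[ub _] := oint_increasing phi_f.
exact: el_int_le_increasing phi_f phif ub.
Qed.

Lemma oint_ge0 f : nonneg_measurable f -> (0 : ext E) <= oint Omega mu f.
Proof.
move=> [mf f0]; have [phi_ phi_f] := elementary_approximation hOmega mf f0.
have /sup_seqP[/(_ 0) ub _] := oint_increasing phi_f.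
exact: le_trans (el_int_ge0 hmu (phi_ 0)) ub.
Qed.

(** Removing [N] from the sets of an elementary function below [f] leaves its
    integral unchanged and moves it below [g]. *)
Lemma oint_le_ae f g N : nonneg_measurable f -> nonneg_measurable g ->
  Omega N -> mu N = 0 -> (forall x, ~ N x -> (f x <= g x)%E) ->
  oint Omega mu f <= oint Omega mu g.
Proof.
move=> [mf f0] mg ON N0 fg.
have [phi_ phi_f] := elementary_approximation hOmega mf f0.
have /sup_seqP[_] := oint_increasing phi_f; apply=> n.
have ONc : Omega (~` N) by exact: sigma_algebra_setC.
pose psi := el_cut hOmega (phi := phi_ n) ler01 (fun=> ONc).
have -> : el_int mu (phi_ n) = el_int mu psi.
  apply: eq_bigr => i _ /=; rewrite mul1r; congr ext_scale.
  set D := el_set i; have OD : Omega D by exact: el_set_mem.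
  rewrite -[in LHS](setIT D) -(setUv N) setIUr (ext_measureU hOmega hmu).
  - rewrite (_ : mu (D `&` N) = 0) ?add0r//; apply/le_anti/andP; split.
      rewrite -N0; apply: (ext_measure_le hOmega hmu) => //.
      exact: sigma_algebra_setI.
    by apply: (ext_measure_ge0 hmu); exact: sigma_algebra_setI.
  - exact: sigma_algebra_setI.
  - exact: sigma_algebra_setI.
  - by rewrite setIACA setICr setI0.
apply: el_int_le_oint => // x; apply: el_fun_le => //; first exact: mg.2.
move=> i /= [ix Nx]; rewrite mul1r; apply: le_trans (fg x Nx).
have phiE : el_fun (phi_ n) x = @el_coef _ _ _ (phi_ n) i.
  exact: (@el_fun_cell _ _ _ (phi_ n) (Some i) x ix).
rewrite -phiE.
exact: increases_to_ge.
Qed.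

Lemma oint_le f g : nonneg_measurable f -> nonneg_measurable g ->
  (forall x, (f x <= g x)%E) -> oint Omega mu f <= oint Omega mu g.
Proof.
move=> mf mg fg; apply: (oint_le_ae (N := set0)) => //.
  exact: sigma_algebra_set0.
by case: hmu.
Qed.

Lemma oint_add f g : nonneg_measurable f -> nonneg_measurable g ->
  oint Omega mu (fun x => f x + g x)%E = oint Omega mu f + oint Omega mu g.
Proof.
move=> [mf f0] [mg g0].
have [phi_ phi_f] := elementary_approximation hOmega mf f0.
have [psi_ psi_g] := elementary_approximation hOmega mg g0.
have addfg : increases_to (fun n => el_add hOmega (phi_ n) (psi_ n))
    (fun x => f x + g x)%E.
  move=> x; have [ndf cvf] := phi_f x; have [ndg cv_g] := psi_g x; split.
    by move=> m n mn; rewrite !el_fun_add lerD ?ndf ?ndg.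
  under eq_fun do rewrite el_fun_add EFinD.
  by apply: cvgeD => //; apply: ge0_adde_def; rewrite inE.
have := oint_increasing addfg; under eq_fun do rewrite el_int_add //.
move=> supfg; apply: (is_subset1_supremums supfg).
apply: (ext_sup_add _ _ (oint_increasing phi_f) (oint_increasing psi_g)).
- by move=> m n mn; apply: (el_int_le hOmega hmu) => x; apply: (phi_f x).1.
- by move=> m n mn; apply: (el_int_le hOmega hmu) => x; apply: (psi_g x).1.
Qed.

Lemma oint_monotone_convergence (f_ : nat -> X -> \bar R) f :
  (forall n, nonneg_measurable (f_ n)) -> nonneg_measurable f ->
  (forall x, nondecreasing_seq (f_ ^~ x)) ->
  (forall x, f_ n x @[n --> \oo] --> f x) ->
  supremums (range (fun n => oint Omega mu (f_ n))) (oint Omega mu f).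
Proof.
move=> mf_ mf ndf cvf; apply/sup_seqP; split=> [n|w le_w].
  apply: oint_le => // x; apply: (cvge_to_ge (cvf x)).
  by near=> m; apply: ndf; near: m; exact: nbhs_infty_ge.
have [phi_ phi_f] := elementary_approximation hOmega mf.1 mf.2.
have /sup_seqP[_] := oint_increasing phi_f; apply=> k.
apply: (@el_int_le_limit _ _ _ hOmega _ _ hmu hE (phi_ k) f_ f) => //.
- by move=> n r; exact: measurable_map_superlevel (mf_ n).1.
- by move=> n; exact: (mf_ n).2.
- by move=> x; exact: increases_to_ge.
- by move=> n psi psif; apply: le_trans (le_w n); exact: el_int_le_oint.
Unshelve. all: by end_near. Qed.

End OrderIntegralTheory.

(** * Order limits of trapped sequences *)

Section OrderLimits.
Variables (R : realType) (E : porderLmodType R).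
Hypothesis hE : sigma_dedekind_complete E.

(** All upper bounds are of the form [l + b n], so the tail suprema exist and
    are squeezed to [l].  No lattice operation such as an absolute value is
    available in [E]: the distance is controlled by its two one-sided
    differences. *)
Lemma order_limsup_of_bound (c b : nat -> E) l :
  infimums (range b) 0 ->
  (forall n k, (n <= k)%N -> c k - l <= b n /\ l - c k <= b n) ->
  is_order_limsup c l.
Proof.
move=> [lbb glb] cb.
have /choice[s sup_s] : forall n, exists s,
    supremums [set c k | k in [set k | (n <= k)%N]] s.
  move=> n; have cnb j : c (n + j)%N <= l + b n.
    by have [] := cb n (n + j)%N (leq_addr _ _); rewrite pov_leBlDr addrC.
  have [s sup_s] := sigma_dedekind_seq_sup hE cnb; exists s.
  rewrite (_ : image _ _ = range (fun j => c (n + j)%N))//.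
  apply/seteqP; split=> _ [k /= nk <-]; last by exists (n + k)%N => //=; exact: leq_addr.
  by exists (k - n)%N => //; rewrite subnKC.
exists s; split=> //; split=> [_ [n _ <-]|z zs].
  suff : l - s n <= 0 by rewrite pov_leBlDr add0r.
  apply: glb => _ [m _ <-].
  have [_] := cb m (maxn m n) (leq_maxl _ _).
  apply: le_trans; apply: pov_leD => //; rewrite pov_leN2.
  by apply: (sup_s n).1; exists (maxn m n) => //=; exact: leq_maxr.
suff : z - l <= 0 by rewrite pov_leBlDr add0r.
apply: glb => _ [n _ <-]; rewrite pov_leBlDr.
apply: (@le_trans _ _ (s n)); first by apply: zs; exists n.
apply: (sup_s n).2 => _ [k /= nk <-].
by have [+ _] := cb n k nk; rewrite pov_leBlDr.
Qed.

Lemma order_liminf_of_bound (c b : nat -> E) l :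
  infimums (range b) 0 ->
  (forall n k, (n <= k)%N -> c k - l <= b n /\ l - c k <= b n) ->
  is_order_liminf c l.
Proof.
move=> infb cb.
have [//|n k nk|s [sup_s [lb_s glb_s]]] :=
    @order_limsup_of_bound (fun k => - c k) b (- l).
  by rewrite !opprK [- c k + _]addrC [- l + _]addrC; have [] := cb n k nk.
exists (fun n => - s n); split=> [n|]; split.
- move=> _ [k /= nk <-]; rewrite -[c k]opprK pov_leN2.
  by apply: (sup_s n).1; exists k.
- move=> z zc; rewrite -[z]opprK pov_leN2.
  apply: (sup_s n).2 => _ [k /= nk <-]; rewrite pov_leN2.
  by apply: zc; exists k.
- by move=> _ [n _ <-]; rewrite -[l]opprK pov_leN2; apply: lb_s; exists n.
- move=> z zs; rewrite -[z]opprK -[l]opprK pov_leN2; apply: glb_s => _ [n _ <-].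
  by rewrite -[s n]opprK pov_leN2; apply: zs; exists n.
Qed.

End OrderLimits.

(** * The integral of real functions and dominated convergence *)
Section DominatedConvergence.
Variables (R : realType) (X : Type) (Omega : set (set X)).
Hypothesis hOmega : sigma_algebra setT Omega.
Variable E : porderLmodType R.
Hypothesis hE : sigma_dedekind_complete E.
Variable mu : set X -> ext E.
Hypothesis hmu : is_ext_measure Omega mu.
Implicit Types f g : X -> R.

Lemma ext_le_fin (x : ext E) w : x <= Fin w -> exists v, x = Fin v.
Proof. by case: x => // v _; exists v. Qed.

Lemma nonneg_measurable_EFin f : measurable_map Omega f -> (forall x, 0 <= f x) ->
  nonneg_measurable Omega (fun x => (f x)%:E).
Proof.
move=> mf f0; split=> [|x]; last by rewrite lee_fin.
exact: (measurable_map_comp (h := EFin)).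
Qed.

Lemma measurable_map_add f g : measurable_map Omega f -> measurable_map Omega g ->
  measurable_map Omega (fun x => f x + g x).
Proof.
apply: (measurable_map_comp2 hOmega (h := fun p : R * R => p.1 + p.2)).
by apply: measurable_funD; [exact: measurable_fst|exact: measurable_snd].
Qed.

Lemma measurable_map_sub f g : measurable_map Omega f -> measurable_map Omega g ->
  measurable_map Omega (fun x => f x - g x).
Proof.
apply: (measurable_map_comp2 hOmega (h := fun p : R * R => p.1 - p.2)).
by apply: measurable_funB; [exact: measurable_fst|exact: measurable_snd].
Qed.

Lemma measurable_map_mul f g : measurable_map Omega f -> measurable_map Omega g ->
  measurable_map Omega (fun x => f x * g x).
Proof.
apply: (measurable_map_comp2 hOmega (h := fun p : R * R => p.1 * p.2)).
by apply: measurable_funM; [exact: measurable_fst|exact: measurable_snd].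
Qed.

Lemma measurable_map_norm f : measurable_map Omega f ->
  measurable_map Omega (fun x => `|f x|).
Proof. exact: (measurable_map_comp (h := fun y : R => `|y|)). Qed.

Lemma measurable_map_indic (A : set X) : Omega A ->
  measurable_map Omega (\1_A : X -> R).
Proof.
move=> OA B _; rewrite preimage_indic; do 2 case: ifP => _ //.
- exact: sigma_algebra_setT.
- exact: sigma_algebra_setC.
- exact: sigma_algebra_set0.
Qed.

Lemma L1_dominated f N (G : X -> \bar R) v : measurable_map Omega f ->
  nonneg_measurable Omega G -> oint Omega mu G = Fin v ->
  Omega N -> mu N = 0 -> (forall x, ~ N x -> (`|f x|%:E <= G x)%E) ->
  L1 Omega mu f.
Proof.
move=> mf mG Gv ON N0 fG; split=> //; apply: (@ext_le_fin _ v); rewrite -Gv.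
apply: (oint_le_ae hOmega hE hmu) ON N0 fG => //.
by apply: nonneg_measurable_EFin => //; exact: measurable_map_norm.
Qed.

Definition decomposition f (f1 f2 : X -> R) (v1 v2 : E) : Prop :=
  [/\ L1 Omega mu f1 /\ L1 Omega mu f2,
      forall x, 0 <= f1 x /\ 0 <= f2 x,
      forall x, f x = f1 x - f2 x &
      oint Omega mu (fun x => (f1 x)%:E) = Fin v1 /\
      oint Omega mu (fun x => (f2 x)%:E) = Fin v2].

Lemma oint_add_fin f g v w : L1 Omega mu f -> L1 Omega mu g ->
  (forall x, 0 <= f x) -> (forall x, 0 <= g x) ->
  oint Omega mu (fun x => (f x)%:E) = Fin v ->
  oint Omega mu (fun x => (g x)%:E) = Fin w ->
  oint Omega mu (fun x => (f x + g x)%:E) = Fin (v + w).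
Proof.
move=> [mf _] [mg _] f0 g0 fv gw; under eq_fun do rewrite EFinD.
rewrite (oint_add hOmega hE hmu) ?fv ?gw//; exact: nonneg_measurable_EFin.
Qed.

(** If [f1 - f2 = g1 - g2], then [f1 + g2 = g1 + f2], and additivity for
    nonnegative functions applies to both sides. *)
Lemma decomposition_unique f f1 f2 v1 v2 g1 g2 w1 w2 :
  decomposition f f1 f2 v1 v2 -> decomposition f g1 g2 w1 w2 ->
  v1 - v2 = w1 - w2.
Proof.
move=> [[Lf1 Lf2] f0 fE [f1v f2v]] [[Lg1 Lg2] g0 gE [g1w g2w]].
have fg x : f1 x + g2 x = g1 x + f2 x.
  by rewrite -(subrK (f2 x) (f1 x)) -fE gE addrAC subrK.
have := oint_add_fin Lf1 Lg2 (fun x => (f0 x).1) (fun x => (g0 x).2) f1v g2w.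
under eq_fun do rewrite fg.
rewrite (oint_add_fin Lg1 Lf2 (fun x => (g0 x).1) (fun x => (f0 x).2) g1w f2v).
move=> [vw]; apply/eqP; rewrite subr_eq addrAC eq_sym subr_eq.
by rewrite vw.
Qed.

(** The positive and negative parts of [f] are dominated by its absolute value,
    so a decomposition exists, and all of them give the same difference. *)
Lemma Lint_decomposition f : L1 Omega mu f ->
  exists f1 f2 v1 v2, decomposition f f1 f2 v1 v2 /\ Lint Omega mu f = v1 - v2.
Proof.
move=> [mf [v fv]].
have mnf := nonneg_measurable_EFin (measurable_map_norm mf) (fun x => normr_ge0 _).
have part (h : X -> R) : measurable_map Omega h -> (forall x, 0 <= h x <= `|f x|) ->
    L1 Omega mu h /\ exists w, oint Omega mu (fun x => (h x)%:E) = Fin w.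
  move=> mh hf.
  have normh x : `|h x| = h x by rewrite ger0_norm//; case/andP: (hf x).
  have [w hw] : exists w, oint Omega mu (fun x => (h x)%:E) = Fin w.
    apply: (@ext_le_fin _ v); rewrite -fv; apply: (oint_le hOmega hE hmu) => //.
      by apply: nonneg_measurable_EFin => // x; case/andP: (hf x).
    by move=> x; rewrite lee_fin; case/andP: (hf x).
  split; last by exists w.
  by split=> //; exists w; under eq_fun do rewrite normh.
have mp : measurable_map Omega (fun x => Num.max (f x) 0).
  apply: (measurable_map_comp (h := fun y : R => Num.max y 0)) => //.
  by apply: measurable_maxr => //.
have mn : measurable_map Omega (fun x => Num.max (- f x) 0).
  apply: (measurable_map_comp (h := fun y : R => Num.max (- y) 0)) => //.
  by apply: measurable_maxr => //; exact: measurableT_comp.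
have [|Lp [v1 pv]] := part _ mp.
  by move=> x; rewrite le_max lexx orbT ge_max ler_norm normr_ge0.
have [|Ln [v2 nv]] := part _ mn.
  by move=> x; rewrite le_max lexx orbT ge_max -normrN ler_norm normr_ge0.
have dec : decomposition f (fun x => Num.max (f x) 0) (fun x => Num.max (- f x) 0) v1 v2.
  split=> // x; first by rewrite !le_max lexx !orbT.
  rewrite /Num.max; case: (ltgtP (f x) 0) => [fx|fx|->].
  - by rewrite oppr_lt0 ltNge ltW//= opprK add0r.
  - by rewrite oppr_lt0 fx subr0.
  - by rewrite oppr0 ltxx subr0.
do 4 eexists; split; first exact: dec.
rewrite /Lint; case: xgetP => [_ _ [g1 [g2 [w1 [w2 [Lg g0 gE gw ->]]]]]|].
  apply: (decomposition_unique (f := f) _ dec); exact: And4 Lg g0 gE gw.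
move=> /(_ (v1 - v2)) []; case: dec => *.
by exists (fun x => Num.max (f x) 0), (fun x => Num.max (- f x) 0), v1, v2.
Qed.

(** With [f = f1 - f2] and [g = g1 - g2], the inequality [f - g <= |f - g|]
    reads [f1 + g2 <= |f - g| + (g1 + f2)], which only involves nonnegative
    functions; linearity of the signed integral is thus avoided. *)
Lemma Lint_sub_le f g a : L1 Omega mu f -> L1 Omega mu g ->
  oint Omega mu (fun x => `|f x - g x|%:E) = Fin a ->
  Lint Omega mu f - Lint Omega mu g <= a.
Proof.
move=> Lf Lg fga.
have [f1 [f2 [v1 [v2 [[[Lf1 Lf2] f0 fE [f1v f2v]] ->]]]]] := Lint_decomposition Lf.
have [g1 [g2 [w1 [w2 [[[Lg1 Lg2] g0 gE [g1w g2w]] ->]]]]] := Lint_decomposition Lg.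
have mfg := measurable_map_sub Lf.1 Lg.1.
have intL := oint_add_fin Lf1 Lg2 (fun x => (f0 x).1) (fun x => (g0 x).2) f1v g2w.
have intR := oint_add_fin Lg1 Lf2 (fun x => (g0 x).1) (fun x => (f0 x).2) g1w f2v.
have m1 : measurable_map Omega (fun x => f1 x + g2 x).
  by apply: measurable_map_add; [exact: Lf1.1|exact: Lg2.1].
have m2 : measurable_map Omega (fun x => g1 x + f2 x).
  by apply: measurable_map_add; [exact: Lg1.1|exact: Lf2.1].
have p1 x : 0 <= f1 x + g2 x by rewrite addr_ge0 ?(f0 x).1 ?(g0 x).2.
have p2 x : 0 <= g1 x + f2 x by rewrite addr_ge0 ?(g0 x).1 ?(f0 x).2.
have nm1 := nonneg_measurable_EFin m1 p1.
have nm2 := nonneg_measurable_EFin m2 p2.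
have nm3 := nonneg_measurable_EFin (measurable_map_norm mfg) (fun x => normr_ge0 _).
have : oint Omega mu (fun x => (f1 x + g2 x)%:E) <=
    oint Omega mu (fun x => `|f x - g x|%:E + (g1 x + f2 x)%:E)%E.
  apply: (oint_le hOmega hE hmu) => //.
    split=> [|x]; last by rewrite -EFinD lee_fin addr_ge0.
    under eq_fun do rewrite -EFinD.
    apply: (measurable_map_comp (h := EFin)) => //.
    by apply: measurable_map_add => //; exact: measurable_map_norm.
  move=> x; rewrite -EFinD lee_fin -lerBlDr; apply: le_trans (ler_norm _).
  rewrite fE gE le_eqVlt; apply/orP; left; apply/eqP.
  by rewrite !opprD opprK addrACA [RHS]addrACA [- f2 x + _]addrC.
rewrite (oint_add hOmega hE hmu) // intL intR fga => le_fin.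
have le_va : v1 + w2 <= a + (w1 + v2) by [].
by rewrite opprB addrA pov_leBlDr [v1 - v2 + w2]addrAC pov_leBlDr -addrA.
Qed.

(** Let [w n] be the supremum of the tail [u k], [k >= n], set to [0] on [N].
    It decreases to [0], hence [w 0 - w n] increases to [w 0], and monotone
    convergence says that [b 0] is the supremum of the [b 0 - b n], where
    [b n] is the integral of [w n].  The integral of [w 0] is finite because
    [w 0 <= G] off [N]. *)
Lemma dominated_null_sequence (u : nat -> X -> R) (G : X -> \bar R) N v :
  (forall k, measurable_map Omega (u k)) -> (forall k x, 0 <= u k x) ->
  nonneg_measurable Omega G -> oint Omega mu G = Fin v ->
  Omega N -> mu N = 0 ->
  (forall x, ~ N x -> u k x @[k --> \oo] --> 0) ->
  (forall k x, ~ N x -> ((u k x)%:E <= G x)%E) ->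
  exists b : nat -> E, infimums (range b) 0 /\
    forall n k, (n <= k)%N -> oint Omega mu (fun x => (u k x)%:E) <= Fin (b n).
Proof.
move=> mu_ u0 mG Gv ON N0 cvu uG.
(* On [N] the sequence [u] may be unbounded; cutting it off there keeps the
   tail suprema real valued at every point. *)
pose u' k x := u k x * \1_(~` N) x.
have u'_out k x : ~ N x -> u' k x = u k x.
  by move=> Nx; rewrite /u' indicE mem_set// mulr1.
have u'_in k x : N x -> u' k x = 0.
  by move=> Nx; rewrite /u' indicE memNset ?mulr0//; exact.
have u'0 k x : 0 <= u' k x by rewrite mulr_ge0// indicE.
have mu' k : measurable_map Omega (u' k).
  by apply: measurable_map_mul => //; apply: measurable_map_indic; exact: sigma_algebra_setC.
have cvu' x : u' k x @[k --> \oo] --> 0.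
  have [Nx|Nx] := pselect (N x).
    by under eq_fun do rewrite u'_in//; exact: cvg_cst.
  by under eq_fun do rewrite u'_out//; exact: cvu.
have ubu' x : has_ubound (range (u' ^~ x)).
  have [M ubM] := cvg_has_ub (cvgP _ (cvu' x)); exists M => _ [k _ <-].
  by apply: le_trans (ler_norm _) _; apply: ubM; exists k.
have ubs x n : has_ubound (sdrop (u' ^~ x) n).
  by case: (ubu' x) => M ubM; exists M => _ [k _ <-]; apply: ubM; exists k.
pose w n x := sups (u' ^~ x) n.
have u'w n k x : (n <= k)%N -> u' k x <= w n x.
  by move=> nk; apply: ub_le_sup => //; exists k.
have w0 n x : 0 <= w n x by apply: le_trans (u'0 n x) (u'w _ _ _ _).
have ndw x : nonincreasing_seq (w ^~ x) by exact: nonincreasing_sups.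
have cvw x : w n x @[n --> \oo] --> 0 by exact: cvg_sups (cvu' x).
have mw n : measurable_map Omega (w n) by exact: measurable_map_sups.
have nmw n := nonneg_measurable_EFin (mw n) (w0 n).
have wG x : ~ N x -> ((w 0 x)%:E <= G x)%E.
  move=> Nx; have := mG.2 x; case GE : (G x) => [r| |] // _; last by rewrite leey.
  rewrite lee_fin; apply: ge_sup; first by exists (u' 0 x); exists 0.
  by move=> _ [k _ <-]; rewrite u'_out// -lee_fin -GE; exact: uG.
have [b0 b0E] : exists b0, oint Omega mu (fun x => (w 0 x)%:E) = Fin b0.
  by apply: (@ext_le_fin _ v); rewrite -Gv; apply: (oint_le_ae hOmega hE hmu) ON N0 wG.
have /choice[b bE] : forall n, exists b, oint Omega mu (fun x => (w n x)%:E) = Fin b.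
  move=> n; apply: (@ext_le_fin _ b0); rewrite -b0E.
  by apply: (oint_le hOmega hE hmu) => // x; rewrite lee_fin; exact: ndw.
exists b; split; last first.
  move=> n k nk; rewrite -bE; apply: (oint_le_ae hOmega hE hmu) ON N0 _ => //.
    exact: nonneg_measurable_EFin.
  by move=> x Nx; rewrite lee_fin -(u'_out k x Nx); exact: u'w.
have md n : measurable_map Omega (fun x => w 0 x - w n x) by exact: measurable_map_sub.
have d0 n x : 0 <= w 0 x - w n x by rewrite subr_ge0; exact: ndw.
have nmd n := nonneg_measurable_EFin (md n) (d0 n).
have dE n : oint Omega mu (fun x => (w 0 x - w n x)%:E) = Fin (b 0 - b n).
  have := oint_add hOmega hE hmu (nmd n) (nmw n).
  under eq_fun do rewrite -EFinD subrK.
  rewrite !bE; case: oint => [d|//] [->]; first by rewrite addrK.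
have /sup_seqP[ubd lubd] : supremums (range (fun n => Fin (b 0 - b n))) (Fin (b 0)).
  have -> : (fun n => Fin (b 0 - b n)) =
      fun n => oint Omega mu (fun x => (w 0 x - w n x)%:E).
    by apply/funext => n; rewrite dE.
  rewrite -bE; apply: (oint_monotone_convergence hOmega hE hmu) => // x.
    by move=> m n mn; rewrite lee_fin lerB//; exact: ndw.
  apply: cvg_EFin; first exact: nearW.
  by rewrite -[X in _ --> X]subr0; apply: cvgB => //; exact: cvg_cst.
split=> [_ [n _ <-]|z zb].
  have := ubd n; rewrite /Order.le /= pov_leBlDr.
  by rewrite -pov_subr_ge0 addrC addKr.
have : Fin (b 0) <= Fin (b 0 - z).
  apply: lubd => n; rewrite /Order.le /=; apply: pov_leD => //.
  by rewrite pov_leN2; apply: zb; exists n.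
rewrite /Order.le /= pov_leBrDr -pov_subr_ge0 opprD addrA subrr add0r.
by rewrite -{1}oppr0 pov_leN2.
Qed.

End DominatedConvergence.

(** * The dominated convergence theorem *)

Theorem theorem6p13 (R : realType) (X : Type) (Omega : set (set X))
    (hOmega : sigma_algebra setT Omega)
    (E : porderLmodType R) (hE : sigma_dedekind_complete E)
    (mu : set X -> ext E) (hmu : is_ext_measure Omega mu)
    (f_ : nat -> X -> R) (hf_ : forall n, measurable_map Omega (f_ n))
    (f : X -> R) (hf : measurable_map Omega f)
    (hlim : almost_all Omega mu (fun x => f_ n x @[n --> \oo] --> f x))
    (hdom : exists g : X -> \bar R,
        [/\ measurable_map Omega g,
            forall x, (0 <= g x)%E,
            exists v : E, oint Omega mu g = Fin v &
            forall n, almost_all Omega mu (fun x => (`|f_ n x|%:E <= g x)%E)]) :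
  [/\ forall n, L1 Omega mu (f_ n),
      L1 Omega mu f,
      exists a : nat -> E,
        (forall k, oint Omega mu (fun x => `|f_ k x - f x|%:E) = Fin (a k)) /\
        is_order_limsup a 0 &
      is_order_liminf (fun k => Lint Omega mu (f_ k)) (Lint Omega mu f) /\
      is_order_limsup (fun k => Lint Omega mu (f_ k)) (Lint Omega mu f)].
Proof.
have [g [mg g0 [v gv] fg]] := hdom.
have nmg : nonneg_measurable Omega g by [].
have [N0 [ON0 muN0 cvN0]] := hlim.
have [M HM] := choice fg.
have OM n : Omega (M n) by case: (HM n).
pose N := N0 `|` \bigcup_n M n.
have ON : Omega N.
  by apply: sigma_algebra_setU => //; exact: sigma_algebra_bigcupT.
have muN : mu N = 0.
  pose D n := if n is n'.+1 then M n' else N0.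
  have -> : N = \bigcup_n D n.
    apply/seteqP; split=> [x [N0x|[n _ Mx]]|x [[|n] _ Dx]].
    - by exists 0.
    - by exists n.+1.
    - by left.
    - by right; exists n.
  apply: (ext_measure_null_bigcup hOmega hmu); first by case.
  by case=> [|n] //=; case: (HM n).
have cvf x : ~ N x -> f_ n x @[n --> \oo] --> f x.
  by move=> Nx; apply: contrapT => /cvN0 N0x; apply: Nx; left.
have f_g n x : ~ N x -> (`|f_ n x|%:E <= g x)%E.
  move=> Nx; apply: contrapT => nle; apply: Nx; right; exists n => //.
  by have [_ _] := HM n; exact.
have fleg x : ~ N x -> (`|f x|%:E <= g x)%E.
  move=> Nx; have cvn : `|f_ n x|%:E @[n --> \oo] --> `|f x|%:E.
    by apply: cvg_EFin; [exact: nearW|exact: cvg_norm (cvf x Nx)].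
  by apply: (cvge_to_le cvn); apply: nearW => n; exact: f_g.
have Lf_ n : L1 Omega mu (f_ n).
  exact: (L1_dominated hOmega hE hmu (hf_ n) nmg gv ON muN (f_g n)).
have Lf : L1 Omega mu f by exact: (L1_dominated hOmega hE hmu hf nmg gv ON muN fleg).
pose u k x := `|f_ k x - f x|.
have mu_ k : measurable_map Omega (u k).
  by apply: measurable_map_norm; exact: measurable_map_sub.
have u0 k x : 0 <= u k x by exact: normr_ge0.
have nmgg : nonneg_measurable Omega (fun x => g x + g x)%E.
  split=> [|x]; last exact: adde_ge0.
  apply: (measurable_map_comp2 hOmega (h := fun p : \bar R * \bar R => (p.1 + p.2)%E)) => //.
  by apply: emeasurable_funD; [exact: measurable_fst|exact: measurable_snd].
have ggv : oint Omega mu (fun x => g x + g x)%E = Fin (v + v).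
  by rewrite (oint_add hOmega hE hmu)// gv.
have ugg k x : ~ N x -> ((u k x)%:E <= g x + g x)%E.
  move=> Nx; apply: le_trans (leeD (f_g k x Nx) (fleg x Nx)).
  by rewrite -EFinD lee_fin; exact: ler_normB.
have cvu x : ~ N x -> u k x @[k --> \oo] --> 0.
  move=> Nx; rewrite -(normr0 R) -(subrr (f x)); apply: cvg_norm.
  by apply: cvgB; [exact: cvf|exact: cvg_cst].
have [b [infb ub]] :=
  dominated_null_sequence hOmega hE hmu mu_ u0 nmgg ggv ON muN cvu ugg.
have /choice[a aE] : forall k, exists a, oint Omega mu (fun x => (u k x)%:E) = Fin a.
  by move=> k; exact: ext_le_fin (ub k k (leqnn k)).
have a0 k : 0 <= a k.
  have := oint_ge0 hOmega hE hmu (nonneg_measurable_EFin (mu_ k) (u0 k)).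
  by rewrite aE.
have ab n k : (n <= k)%N -> a k <= b n by move=> nk; have := ub n k nk; rewrite aE.
have Lfb n k : (n <= k)%N -> Lint Omega mu (f_ k) - Lint Omega mu f <= b n /\
    Lint Omega mu f - Lint Omega mu (f_ k) <= b n.
  move=> nk; split; apply: le_trans (ab n k nk); apply: (Lint_sub_le hOmega hE hmu) => //.
    exact: aE.
  by under eq_fun do rewrite distrC; exact: aE.
split => //.
  exists a; split=> //; apply: (order_limsup_of_bound hE infb) => n k nk.
  rewrite subr0 sub0r; split; first exact: ab.
  by apply: le_trans (ab n k nk); apply: le_trans (a0 k); rewrite -oppr0 pov_leN2.
split; first exact: (order_liminf_of_bound hE infb).
exact: (order_limsup_of_bound hE infb).
Qed.
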